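(* Let $R$ be a commutative ring with non-zero identity. The following statements are equivalent: (1) $R$ is a quasi-local ring. (2) Every proper ideal of $R$ is a $J$-ideal. (3) Every proper ideal of $R$ is a quasi $J$-ideal. (4) Every proper ideal of $R$ is a weakly $J$-ideal. (5) Every proper principal ideal of $R$ is a weakly $J$-ideal.
   Context: All rings are commutative with non-zero identity; $J(R)$ denotes the Jacobson radical of $R$. A ring is quasi-local if it has exactly one maximal ideal (no Noetherian assumption). A proper ideal $I$ of $R$ is a $J$-ideal if whenever $a,b\in R$ with $ab\in I$ and $a\notin J(R)$, then $b\in I$. A proper ideal $I$ is a quasi $J$-ideal if its radical $\sqrt{I}=\{x\in R: x^n\in I \text{ for some } n\in\mathbb{N}\}$ is a $J$-ideal. A proper ideal $I$ is a weakly $J$-ideal if whenever $a,b\in R$ with $0\neq ab\in I$ and $a\notin J(R)$, then $b\in I$. *)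

(* Defs.v *)
From HB Require Import structures.
From mathcomp Require Import all_boot all_algebra.
From mathcomp Require Import boolp classical_sets.

Set Implicit Arguments.
Unset Strict Implicit.
Unset Printing Implicit Defensive.

Import GRing.Theory.
Local Open Scope ring_scope.
Local Open Scope classical_set_scope.

(* Ideals are arbitrary [set R]s rather than decidable predicates.  The
   library's [idealr_closed] contains the clause [1 \notin I], so it already
   describes the proper ideals. *)
Definition is_proper_ideal (R : comNzRingType) (I : set R) : Prop :=
  idealr_closed [in I].

Definition maximal_ideal (R : comNzRingType) (M : set R) : Prop :=
  is_proper_ideal M /\
  forall I : set R, is_proper_ideal I -> M `<=` I -> I = M.

Definition quasi_local (R : comNzRingType) : Prop :=
  exists! M : set R, maximal_ideal M.

Definition jacobson (R : comNzRingType) : set R :=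
  \bigcap_(M in @maximal_ideal R) M.

Definition ideal_radical (R : comNzRingType) (I : set R) : set R :=
  [set x | exists2 n : nat, (0 < n)%N & I (x ^+ n)].

Definition principal_ideal (R : comNzRingType) (a : R) : set R :=
  [set r * a | r in [set: R]].

Definition J_ideal (R : comNzRingType) (I : set R) : Prop :=
  is_proper_ideal I /\
  forall a b : R, I (a * b) -> ~ jacobson a -> I b.

Definition quasi_J_ideal (R : comNzRingType) (I : set R) : Prop :=
  is_proper_ideal I /\ J_ideal (ideal_radical I).

Definition weakly_J_ideal (R : comNzRingType) (I : set R) : Prop :=
  is_proper_ideal I /\
  forall a b : R, a * b <> 0 -> I (a * b) -> ~ jacobson a -> I b.

(* Main.v *)
Require Import Defs.
From mathcomp Require Import all_boot all_algebra.
From mathcomp Require Import boolp classical_sets.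

(** Each of (1)-(5) amounts to: every element outside the Jacobson radical is
    invertible.  Indeed a J-type condition on the principal ideal of a
    non-invertible [a] outside the radical, applied to [a * 1], puts [1] in that
    ideal (or in its radical).  Conversely the J-ideal condition is vacuous for
    an invertible [a], and every maximal ideal, being made of non-invertible
    elements, equals the Jacobson radical. *)

Set Implicit Arguments.
Unset Strict Implicit.
Unset Printing Implicit Defensive.

Import GRing.Theory.
Local Open Scope ring_scope.
Local Open Scope classical_set_scope.

Lemma proper_idealP (R : comNzRingType) (I : set R) :
  is_proper_ideal I <->
  [/\ I 0, ~ I 1 & forall a u v, I u -> I v -> I (a * u + v)].
Proof.
split=> [[/set_mem I0 /negP I1 Il]|[I0 I1 Il]]; split=> //.
- by move=> /mem_set.
- by move=> a u v /mem_set Iu /mem_set Iv; apply/set_mem/Il.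
- exact/mem_set.
- by apply/negP => /set_mem.
- by move=> a u v /set_mem Iu /set_mem Iv; apply/mem_set/Il.
Qed.

Lemma proper_idealMl (R : comNzRingType) (I : set R) (a u : R) :
  is_proper_ideal I -> I u -> I (a * u).
Proof. by move=> /proper_idealP[I0 _ Il] Iu; rewrite -[a * u]addr0; apply: Il. Qed.

Lemma principal_ideal_id (R : comNzRingType) (a : R) : principal_ideal a a.
Proof. by exists 1; rewrite ?mul1r. Qed.

Lemma proper_principal_ideal (R : comNzRingType) (a : R) :
  ~ principal_ideal a 1 -> is_proper_ideal (principal_ideal a).
Proof.
move=> a1; apply/proper_idealP; split=> //; first by exists 0; rewrite ?mul0r.
by move=> b _ _ [r _ <-] [s _ <-]; exists (b * r + s); rewrite // mulrDl mulrA.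
Qed.

Lemma proper_ideal_sub_maximal (R : comNzRingType) (I : set R) :
  is_proper_ideal I -> exists2 M, maximal_ideal M & I `<=` M.
Proof.
move=> Iid; have /proper_idealP[I0 I1 Il] := Iid.
(* Taking unions with [I] makes the empty chain harmless in Zorn's lemma. *)
have [F FP Ftot|A [PA Amax]] := @Zorn_bigcup R [set A | is_proper_ideal (I `|` A)].
- have chain A B : F A -> F B -> exists2 C, F C & A `|` B `<=` C.
    move=> FA FB; have [AB|BA] := Ftot _ _ FA FB.
      by exists B => // x [/AB|].
    by exists A => // x [|/BA].
  apply/proper_idealP; split; first by left.
  case=> // -[A /FP /proper_idealP[_ A1 _] A_1]; by apply: A1; right.
  (* Closure is checked inside one member of the chain at a time; elements of two members are first
     moved into the larger one. *)
  have lin A a u v : F A -> (I `|` A) u -> (I `|` A) v ->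
      (I `|` \bigcup_(B in F) B) (a * u + v).
    move=> FA Au Av; have /proper_idealP[_ _ Al] := FP _ FA.
    by have [|Auv] := Al a _ _ Au Av; [left|right; exists A].
  move=> a u v [Iu|[A FA Au]] [Iv|[B FB Bv]].
  + by left; apply: Il.
  + by apply: (lin B) => //; [left|right].
  + by apply: (lin A) => //; [right|left].
  + have [C FC ABC] := chain _ _ FA FB.
    by apply: (lin C) => //; right; apply: ABC; [left|right].
(* A proper ideal [B] containing [I] and [A] equals its union with [I], so it competes with [A] in
   Zorn's conclusion and cannot be strictly larger. *)
- exists (I `|` A); last exact: subsetUl.
  split=> // B Bid; rewrite subUset => -[IB AB].
  have PB : is_proper_ideal (I `|` B) by rewrite (setUidr IB).
  suff -> : A = B by rewrite (setUidr IB).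
  apply: contrapT => AneB; apply: (Amax B) => //.
  by rewrite properEneq; split=> //; apply/eqP.
Qed.

(** A non-invertible element lies in some maximal ideal; when there is only one, that ideal is the
    Jacobson radical. *)
Lemma quasi_local_principal1 (R : comNzRingType) (a : R) :
  quasi_local R -> ~ jacobson a -> principal_ideal a 1.
Proof.
move=> [M [_ Muniq]] aJ; apply: contrapT => /proper_principal_ideal.
move=> /proper_ideal_sub_maximal[N Nmax aN]; apply: aJ => K Kmax.
by rewrite -(Muniq _ Kmax) (Muniq _ Nmax); apply/aN/principal_ideal_id.
Qed.

Lemma principal1_quasi_local (R : comNzRingType) :
  (forall a : R, ~ jacobson a -> principal_ideal a 1) -> quasi_local R.
Proof.
move=> unitJ.
have maxE (M : set R) : maximal_ideal M -> M = @jacobson R.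
  move=> Mmax; apply/seteqP; split=> [a Ma|a]; last exact.
  have [Mid _] := Mmax; have /proper_idealP[_ M1 _] := Mid.
  apply: contrapT => /unitJ[r _ ra1]; apply: M1; rewrite -ra1.
  exact: proper_idealMl.
(* Existence of a maximal ideal: the zero ideal is proper because the ring is non-zero. *)
have /proper_principal_ideal/proper_ideal_sub_maximal[M Mmax _] :
    ~ principal_ideal (0 : R) 1.
  by move=> [r _ /eqP]; rewrite mulr0 eq_sym oner_eq0.
by exists M; split=> // N /maxE ->; exact: maxE.
Qed.

Lemma principal1_cancel (R : comNzRingType) (I : set R) (a b : R) :
  is_proper_ideal I -> principal_ideal a 1 -> I (a * b) -> I b.
Proof.
by move=> Iid [r _ ra1] /(proper_idealMl r Iid); rewrite mulrA ra1 mul1r.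
Qed.

Lemma proper_ideal_radical (R : comNzRingType) (I : set R) :
  is_proper_ideal I -> is_proper_ideal (ideal_radical I).
Proof.
move=> Iid; have /proper_idealP[I0 I1 Il] := Iid.
apply/proper_idealP; split; first by exists 1%N.
  by move=> [n _]; rewrite expr1n.
move=> a u v [m m0 Ium] [n n0 Ivn]; exists (m + n)%N; first by rewrite addn_gt0 m0.
rewrite exprDn; elim/big_ind: _ => // [x y Ix Iy|i _].
  by rewrite -[x]mul1r; apply: Il.
rewrite -mulr_natl; apply: proper_idealMl => //.
(* In the binomial term of index [i], [v] has exponent [i] and [a * u] has exponent [m + n - i];
   either the former is at least [n] or the latter at least [m]. *)
have [ni|ni] := leqP n i.
  by rewrite -(subnK ni) exprD mulrA; apply: proper_idealMl.
have mi : (m <= m + n - i)%N by rewrite -addnBA ?leq_addr // ltnW.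
rewrite mulrC exprMn -(subnK mi) [u ^+ _]exprD !mulrA.
exact: proper_idealMl.
Qed.

Theorem theorem1 (R : comNzRingType) :
  [<-> quasi_local R;
       forall I : set R, is_proper_ideal I -> J_ideal I;
       forall I : set R, is_proper_ideal I -> quasi_J_ideal I;
       forall I : set R, is_proper_ideal I -> weakly_J_ideal I;
       forall a : R, is_proper_ideal (principal_ideal a) ->
         weakly_J_ideal (principal_ideal a)].
Proof.
tfae.
- move=> Rql I Iid; split=> // a b Iab aJ.
  exact: (principal1_cancel Iid (quasi_local_principal1 Rql aJ)).
- by move=> RJ I Iid; split=> //; apply/RJ/proper_ideal_radical.
- move=> RqJ I Iid; split=> // a b _ Iab aJ; apply: principal1_cancel Iid _ Iab.
  apply: contrapT => na1; apply: (na1).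
  have [_ [_ radJ]] := RqJ _ (proper_principal_ideal na1).
  (* Once 1 is in the radical, some power of 1, hence 1 itself, is in the principal ideal. *)
  have [|//|n n0] := radJ a 1.
    by rewrite mulr1; exists 1%N => //; apply: principal_ideal_id.
  by rewrite expr1n.
- by move=> RwJ a; apply: RwJ.
- move=> RwJ; apply: principal1_quasi_local => a aJ; apply: contrapT => na1.
  have [_ wJ] := RwJ a (proper_principal_ideal na1).
  apply: na1; apply: (wJ a) => //; rewrite mulr1; last exact: principal_ideal_id.
  (* The weak condition needs a non-zero product: [a] cannot be 0, since 0 lies in every maximal
     ideal and [a] is outside the radical. *)
  move=> a0; apply: aJ; rewrite a0 => M [/proper_idealP[M0 _ _] _]; exact: M0.
Qed.
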